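(* Let $m,n\in\mathbb{Z}_{>0}$, and let $\boldsymbol{u}\in\mathbb{R}_{>0}^m$, $\boldsymbol{v}\in\mathbb{R}_{>0}^n$ with $\|\boldsymbol{u}\|_1=\|\boldsymbol{v}\|_1=1$. Let $\rho\ge 0$ and $\varepsilon,\kappa\in(0,1]$. Let $C\in\mathbb{R}_{>0}^{m\times n}$ and $\eta>0$ be such that $\eta C$ is $(\rho,\kappa)$-well-bounded with respect to $(\boldsymbol{u},\boldsymbol{v})$. Then, with input $(\exp(-\eta C),(\boldsymbol{u},\boldsymbol{v}))$ (exponential applied entrywise), the SK algorithm outputs a matrix $A$ (i.e. some iterate $A=A^{(k)}$) satisfying $$\|\boldsymbol{r}(A)-\boldsymbol{u}\|_1+\|\boldsymbol{c}(A)-\boldsymbol{v}\|_1\le\varepsilon$$ within $O\bigl(e^{14\rho}\,\kappa^{-6}\,(\rho+\log n-\log\varepsilon-\log\kappa)\bigr)$ iterations.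
   Context: For a nonnegative matrix $A\in\mathbb{R}_{\ge0}^{m\times n}$, $r_i(A)=\sum_j A_{ij}$, $c_j(A)=\sum_i A_{ij}$, $\boldsymbol{r}(A)=(r_1(A),\dots,r_m(A))$, $\boldsymbol{c}(A)=(c_1(A),\dots,c_n(A))$. Sinkhorn–Knopp (SK) algorithm: given nonzero $A\in\mathbb{R}_{\ge0}^{m\times n}$ and positive $\boldsymbol{u}\in\mathbb{R}^m,\boldsymbol{v}\in\mathbb{R}^n$ with $\|\boldsymbol{u}\|_1=\|\boldsymbol{v}\|_1$, it produces $A^{(0)},A^{(1)},\dots$ with $A^{(0)}_{ij}=u_iA_{ij}/r_i(A)$; for odd $k$, $A^{(k)}_{ij}=v_jA^{(k-1)}_{ij}/c_j(A^{(k-1)})$; for even $k\ge2$, $A^{(k)}_{ij}=u_iA^{(k-1)}_{ij}/r_i(A^{(k-1)})$. ''SK outputs a matrix satisfying $P$ within $T$ iterations'' means some $A^{(k)}$ with $k\le T$ satisfies $P$. The $O(\cdot)$ hides an absolute constant. Well-boundedness: for a matrix $M\in\mathbb{R}^{m\times n}$, $\rho\ge0$, $\kappa>0$ and weight vectors $\boldsymbol{u},\boldsymbol{v}$ of unit $\ell_1$ norm, define $r_\rho(M;\boldsymbol{v})=\min_{i\in[m]}\sum_{j\in[n]}v_j\mathbf{1}[M_{ij}\le\rho]$ and $c_\rho(M;\boldsymbol{u})=\min_{j\in[n]}\sum_{i\in[m]}u_i\mathbf{1}[M_{ij}\le\rho]$; $M$ is $(\rho,\kappa)$-well-bounded with respect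 to $(\boldsymbol{u},\boldsymbol{v})$ if $r_\rho(M;\boldsymbol{v})+c_\rho(M;\boldsymbol{u})\ge1+\kappa$. *)

(* Defs.v *)
From HB Require Import structures.
From mathcomp Require Import all_boot all_order all_algebra.
From mathcomp Require Import all_classical all_reals all_analysis.

Set Implicit Arguments.
Unset Strict Implicit.
Unset Printing Implicit Defensive.

Import Order.TTheory GRing.Theory Num.Theory.

Local Open Scope ring_scope.

Definition row_sums (R : realType) (m n : nat) (A : 'M[R]_(m, n)) : 'rV[R]_m :=
  \row_i \sum_(j < n) A i j.

Definition col_sums (R : realType) (m n : nat) (A : 'M[R]_(m, n)) : 'rV[R]_n :=
  \row_j \sum_(i < m) A i j.

(* The norm `|x| that MathComp-Analysis puts on matrices is the sup norm. *)
Definition l1norm (R : realType) (n : nat) (x : 'rV[R]_n) : R :=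
  \sum_(j < n) `|x 0 j|.

Definition row_scale (R : realType) (m n : nat) (u : 'rV[R]_m)
    (A : 'M[R]_(m, n)) : 'M[R]_(m, n) :=
  \matrix_(i, j) (u 0 i * A i j / row_sums A 0 i).

Definition col_scale (R : realType) (m n : nat) (v : 'rV[R]_n)
    (A : 'M[R]_(m, n)) : 'M[R]_(m, n) :=
  \matrix_(i, j) (v 0 j * A i j / col_sums A 0 j).

Fixpoint SK (R : realType) (m n : nat) (A : 'M[R]_(m, n))
    (u : 'rV[R]_m) (v : 'rV[R]_n) (k : nat) : 'M[R]_(m, n) :=
  if k is k'.+1 then
    if odd k then col_scale v (SK A u v k') else row_scale u (SK A u v k')
  else row_scale u A.

Definition SK_outputs_within (R : realType) (m n : nat) (A : 'M[R]_(m, n))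
    (u : 'rV[R]_m) (v : 'rV[R]_n) (P : 'M[R]_(m, n) -> Prop) (T : R) : Prop :=
  exists k : nat, k%:R <= T /\ P (SK A u v k).

(* The dimensions are m.+1 and n.+1, so both minima range over nonempty sets;
   the value at ord0 serves as the default of the iterated minimum. *)
Definition min_ord (R : realType) (n : nat) (F : 'I_n.+1 -> R) : R :=
  \big[Num.min/F ord0]_(i < n.+1) F i.

Definition r_rho (R : realType) (m n : nat) (rho : R)
    (M : 'M[R]_(m.+1, n.+1)) (v : 'rV[R]_n.+1) : R :=
  min_ord (fun i => \sum_(j < n.+1) v 0 j * (M i j <= rho)%R%:R).

Definition c_rho (R : realType) (m n : nat) (rho : R)
    (M : 'M[R]_(m.+1, n.+1)) (u : 'rV[R]_m.+1) : R :=
  min_ord (fun j => \sum_(i < m.+1) u 0 i * (M i j <= rho)%R%:R).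

Definition well_bounded (R : realType) (m n : nat) (rho kappa : R)
    (M : 'M[R]_(m.+1, n.+1)) (u : 'rV[R]_m.+1) (v : 'rV[R]_n.+1) : Prop :=
  1 + kappa <= r_rho rho M v + c_rho rho M u.

(* Main.v *)
Require Import Defs.
From HB Require Import structures.
From mathcomp Require Import all_boot all_order all_algebra.
From mathcomp Require Import all_classical all_reals all_analysis.
From mathcomp Require Import ring lra.

(* Write the iterates as u_i a_i A_ij v_j b_j with A = exp(-eta C) <= 1, and let
   delta = exp(-rho).  The dual value sum u ln a + sum v ln b starts above
   - ln n and increases by at least kappa^2/32 in each pair of steps as long as
   the column error exceeds kappa/2.  Once the error is at most kappa/2,
   row i and column j meet the entries A >= delta in a block that carries mass
   at least kappa/2, which forces a_i b_j <= Lam := 2/(delta^2 kappa); hence the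
   dual value never exceeds ln Lam, and the error is at most kappa/2 after
   O(kappa^-2 (rho + ln n - ln kappa)) steps.  From then on the bound on a_i b_j,
   together with 1 <= b_j max a, bounds max a / min a and max b / min b.  A step
   maps the error vector by a stochastic matrix; since r + c >= 1 + kappa,
   either any two rows or any two columns of the dense pattern overlap in measure kappa, so
   one of the two alternating steps contracts the l1 error by
   1 - delta^4 kappa^3 / 2 (Dobrushin), and the other does not increase it. *)

Set Implicit Arguments.
Unset Strict Implicit.
Unset Printing Implicit Defensive.

Import Order.TTheory GRing.Theory Num.Theory.

Local Open Scope ring_scope.

(** * Logarithmic inequalities and contraction by stochastic matrices *)

Section Inequalities.
Variable R : realType.
Implicit Types (s t x : R).

Lemma ln_le_subr1 x : 0 < x -> ln x <= x - 1.
Proof.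
move=> x0; have := @le_ln1Dx R (x - 1); rewrite [1 + _]addrC subrK.
by apply; lra.
Qed.

(** Add ln x <= x - 1 at x = (1 - r) t and at x = 1 / (1 - r), where r is s or - s according to the
    sign of t - 1. *)
Lemma ln_le_subr1_abs s t : 0 < t -> 0 <= s -> 2 * s <= 1 ->
  ln t <= (t - 1) - s * `|t - 1| + 2 * s ^+ 2.
Proof.
move=> t0 s0 s1.
have key r : `|r| <= 2^-1 -> ln t <= (1 - r) * (t - 1) + 2 * r ^+ 2.
  rewrite ler_norml => /andP[r1 r2].
  have r3 : 0 < 1 - r by lra.
  have := ln_le_subr1 (mulr_gt0 r3 t0).
  rewrite lnM ?posrE// => h.
  have := ln_le_subr1 (x := (1 - r)^-1).
  rewrite invr_gt0 lnV ?posrE// => /(_ r3) h'.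
  suff : (1 - r)^-1 <= 1 + r + 2 * r ^+ 2 by nra.
  by rewrite -[leLHS]mul1r ler_pdivrMr//; nra.
have [t1|t1] := lerP 1 t.
  by have := key s; rewrite ger0_norm//; nra.
by have := key (- s); rewrite normrN ger0_norm// sqrrN; nra.
Qed.

(* A form of Pinsker's inequality, linearised at slope s: optimising s
   gives the relative entropy as a square of the total variation. *)
Lemma sum_ln_le (J : finType) (v t : J -> R) s :
  (forall j, 0 <= v j) -> (forall j, 0 < t j) ->
  \sum_j v j = 1 -> \sum_j v j * t j = 1 -> 0 <= s -> 2 * s <= 1 ->
  \sum_j v j * ln (t j) <= 2 * s ^+ 2 - s * \sum_j v j * `|t j - 1|.
Proof.
move=> v0 t0 v1 vt1 s0 s1.
have -> : 2 * s ^+ 2 - s * (\sum_j v j * `|t j - 1|) =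
    \sum_j v j * ((t j - 1) - s * `|t j - 1| + 2 * s ^+ 2).
  rewrite [RHS](eq_bigr (fun j => v j * t j + (2 * s ^+ 2 - 1) * v j
      - s * (v j * `|t j - 1|))); last by move=> j _; ring.
  by rewrite sumrB big_split/= -!mulr_sumr v1 vt1; ring.
by apply: ler_sum => j _; rewrite ler_wpM2l// ln_le_subr1_abs.
Qed.

(* Dobrushin: split w into its positive and negative parts p and q, which
   have the same mass, and couple them by the product p * q. *)
Lemma stochastic_contraction (I J : finType) (K : I -> J -> R) (w : J -> R)
    (theta : R) :
  (forall j, \sum_i K i j = 1) -> \sum_j w j = 0 ->
  (forall j j', theta <= \sum_i Num.min (K i j) (K i j')) ->
  \sum_i `|\sum_j K i j * w j| <= (1 - theta) * \sum_j `|w j|.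
Proof.
move=> K1 w0 Kmin.
pose p j := Num.max (w j) 0; pose q j := Num.max (- w j) 0.
have p0 j : 0 <= p j by rewrite /p le_max lexx orbT.
have q0 j : 0 <= q j by rewrite /q le_max lexx orbT.
have wpq j : w j = p j - q j.
  by rewrite /p /q; case: (lerP (w j) 0); case: (lerP (- w j) 0); lra.
have nwpq j : `|w j| = p j + q j.
  rewrite /p /q; case: (lerP (w j) 0) => h; case: (lerP (- w j) 0) => h';
  by [rewrite ler0_norm//; lra | rewrite gtr0_norm//; lra].
pose S := \sum_j p j.
have qS : \sum_j q j = S.
  apply/esym/eqP; rewrite -subr_eq0 -sumrB -[X in _ == X]w0; apply/eqP.
  by apply: eq_bigr => j _; rewrite wpq.
have S2 : \sum_j `|w j| = 2 * S.
  by rewrite (eq_bigr _ (fun j _ => nwpq j)) big_split/= qS /S; ring.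
have S0 : 0 <= S by apply: sumr_ge0.
have [S00|Sn0] := eqVneq S 0.
  have wj0 j : w j = 0.
    apply/eqP; rewrite -normr_eq0.
    have : \sum_j `|w j| == 0 by rewrite S2 S00 mulr0.
    by rewrite psumr_eq0// => /allP/(_ j); rewrite mem_index_enum => /(_ isT).
  rewrite S2 S00 !mulr0 big1// => i _; rewrite big1 ?normr0// => j _.
  by rewrite wj0 mulr0.
have Sp : 0 < S by rewrite lt_def Sn0.
(* As p and q both have mass S, S times the image of w = p - q is the sum of p_j q_j' (K_ij -
   K_ij'); hence the factor S. *)
rewrite -(ler_pM2l Sp) mulr_sumr S2.
have tv j j' : \sum_i `|K i j - K i j'| <= 2 * (1 - theta).
  rewrite (eq_bigr (fun i => K i j + K i j' - 2 * Num.min (K i j) (K i j'))).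
    by rewrite sumrB big_split/= !K1 -mulr_sumr; have := Kmin j j'; lra.
  move=> i _; case: (lerP (K i j) (K i j')) => h.
    by ring.
  by ring.
have couple i : S * `|\sum_j K i j * w j| <=
    \sum_j \sum_j' p j * q j' * `|K i j - K i j'|.
  have -> : S * `|\sum_j K i j * w j| =
      `|\sum_j \sum_j' p j * q j' * (K i j - K i j')|.
    rewrite -{1}(ger0_norm S0) -normrM; congr `|_|.
    rewrite [RHS](eq_bigr (fun j => S * (K i j * p j)
        - p j * \sum_j' K i j' * q j')); last first.
      move=> j _; rewrite -qS mulr_suml mulr_sumr -sumrB.
      by apply: eq_bigr => j' _; ring.
    rewrite sumrB -mulr_sumr -mulr_suml -/S -mulrBr -sumrB; congr (_ * _).
    by apply: eq_bigr => j _; rewrite wpq; ring.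
  apply: le_trans (ler_norm_sum _ _ _) _; apply: ler_sum => j _.
  apply: le_trans (ler_norm_sum _ _ _) _; apply: ler_sum => j' _.
  by rewrite normrM ger0_norm// mulr_ge0.
apply: le_trans (ler_sum _ (fun i _ => couple i)) _.
rewrite exchange_big/=.
apply: (@le_trans _ _ (\sum_j \sum_j' p j * q j' * (2 * (1 - theta)))).
  apply: ler_sum => j _; rewrite exchange_big/=; apply: ler_sum => j' _.
  by rewrite -mulr_sumr ler_wpM2l// mulr_ge0.
rewrite (eq_bigr (fun j => p j * (S * (2 * (1 - theta))))); last first.
  move=> j _; rewrite -qS mulr_suml mulr_sumr.
  by apply: eq_bigr => j' _; ring.
by rewrite -mulr_suml -/S; lra.
Qed.

Lemma marginal_measure_le1 (K : finType) (w : K -> R) (s : K -> bool) :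
  (forall k, 0 < w k) -> \sum_k w k = 1 -> \sum_k w k * (s k)%:R <= 1.
Proof.
move=> w0 w1; rewrite -[leRHS]w1; apply: ler_sum => k _.
by case: (s k); rewrite ?mulr1 ?mulr0// ltW.
Qed.

Lemma inhabited_sum1 (K : finType) (w : K -> R) : \sum_k w k = 1 -> inhabited K.
Proof.
move=> w1; apply: contrapT => nK; have := oner_neq0 R.
by rewrite -w1 big1 ?eqxx// => k; case: nK.
Qed.

End Inequalities.

(* Scalings are written relative to the target marginals: the matrix obtained
   from A by the factors a and b has entries u_i a_i A_ij v_j b_j, and b is
   balanced against a when this matrix has column sums v. *)
Definition balanced (R : realType) (I J : finType) (A : I -> J -> R)
    (u a : I -> R) (b : J -> R) : Prop :=
  forall j, b j * \sum_i A i j * u i * a i = 1.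

(** When b' is balanced against a, the matrix with factors a and b has column sums v_j b_j / b'_j,
    so this is their l1 distance from v. *)
Definition deviation (R : realType) (J : finType) (v b b' : J -> R) : R :=
  \sum_j v j * `|b j / b' j - 1|.

(** * One half-step of the alternating scaling *)

Section HalfStep.
Variables (R : realType) (I J : finType).
Variables (A : I -> J -> R) (u : I -> R) (v : J -> R).
Variables (a a' : I -> R) (b b' : J -> R).
Hypothesis A0 : forall i j, 0 < A i j.
Hypotheses (u0 : forall i, 0 < u i) (v0 : forall j, 0 < v j).
Hypotheses (u1 : \sum_i u i = 1) (v1 : \sum_j v j = 1).
Hypotheses (a0 : forall i, 0 < a i) (b0 : forall j, 0 < b j).
Hypothesis ab : balanced (fun j i => A i j) v b a.
Hypothesis ab' : balanced A u a b'.

Lemma balanced_gt0 j : 0 < b' j.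
Proof.
have s0 : 0 <= \sum_i A i j * u i * a i.
  by apply: sumr_ge0 => i _; rewrite !mulr_ge0// ltW.
have := ab' j; have [b'0|//] := lerP (b' j) 0.
by have := mulr_le0_ge0 b'0 s0; lra.
Qed.

(** The terms are the column sums of the matrix with factors a and b, whose row sums are u. *)
Lemma balanced_mass : \sum_j v j * (b j / b' j) = 1.
Proof.
have bb' j : v j * (b j / b' j) = \sum_i u i * (a i * (A i j * v j * b j)).
  rewrite (mulr1_eq (ab' j)) mulrA mulr_sumr.
  by apply: eq_bigr => i _; ring.
rewrite (eq_bigr _ (fun j _ => bb' j)) exchange_big/= -u1.
by apply: eq_bigr => i _; rewrite -!mulr_sumr ab mulr1.
Qed.

(** [sum_ln_le] applies to t = b / b' by [balanced_mass]: rebalancing b gains a relative entropy,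
    which the error bounds from below. *)
Lemma sum_ln_balanced s : 0 <= s -> 2 * s <= 1 ->
  \sum_j v j * ln (b j) + s * deviation v b b' <=
  \sum_j v j * ln (b' j) + 2 * s ^+ 2.
Proof.
move=> s0 s1.
have := sum_ln_le (fun j => ltW (v0 j))
  (fun j => divr_gt0 (b0 j) (balanced_gt0 j)) v1 balanced_mass s0 s1.
rewrite (eq_bigr (fun j => v j * ln (b j) - v j * ln (b' j))); last first.
  by move=> j _; rewrite ln_div ?posrE ?balanced_gt0// mulrBr.
by rewrite sumrB -/(deviation v b b'); lra.
Qed.

Hypothesis ab'' : balanced (fun j i => A i j) v b' a'.

(** The matrix u_i a_i A_ij b'_j has column sums 1 and sends the error v_j (1 - b_j / b'_j), of sum
    0, to u_i (a_i / a'_i - 1). *)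
Lemma deviation_contraction theta :
  (forall j j', theta <=
     \sum_i Num.min (u i * a i * A i j * b' j) (u i * a i * A i j' * b' j')) ->
  deviation u a a' <= (1 - theta) * deviation v b b'.
Proof.
move=> Kmin.
have := stochastic_contraction (K := fun i j => u i * a i * A i j * b' j)
  (w := fun j => v j * (1 - b j / b' j)) _ _ Kmin.
have -> : \sum_j `|v j * (1 - b j / b' j)| = deviation v b b'.
  by apply: eq_bigr => j _; rewrite normrM gtr0_norm// distrC.
suff -> : \sum_i `|\sum_j u i * a i * A i j * b' j * (v j * (1 - b j / b' j))| =
    deviation u a a'.
  apply.
    move=> j; rewrite -(ab' j) mulr_sumr; apply: eq_bigr => i _; ring.
  rewrite (eq_bigr (fun j => v j - v j * (b j / b' j))).
    by rewrite sumrB balanced_mass v1 subrr.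
  by move=> j _; ring.
apply: eq_bigr => i _; rewrite -[X in X * `|_|](gtr0_norm (u0 i)) -normrM.
congr `|_|.
rewrite (eq_bigr (fun j => u i * (a i * (A i j * v j * b' j)
     - a i * (A i j * v j * b j)))); last first.
  by move=> j _; field; apply: lt0r_neq0; exact: balanced_gt0.
rewrite -mulr_sumr sumrB -!mulr_sumr ab; congr (_ * (a i * _ - _)).
by rewrite (mulr1_eq (ab'' i)).
Qed.

Lemma deviation_nonincreasing : deviation u a a' <= deviation v b b'.
Proof.
have := @deviation_contraction 0; rewrite subr0 mul1r; apply=> j j'.
apply: sumr_ge0 => i _; rewrite le_min.
by rewrite !mulr_ge0 ?ltW// ?balanced_gt0//.
Qed.

End HalfStep.

(** * Bounds on balanced factors *)

Section ScalingBounds.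
Variables (R : realType) (I J : finType).
Variables (A : I -> J -> R) (u a : I -> R) (b : J -> R).
Hypothesis A0 : forall i j, 0 < A i j.
Hypothesis u0 : forall i, 0 < u i.
Hypotheses (a0 : forall i, 0 < a i) (b0 : forall j, 0 < b j).
Hypothesis ab : balanced A u a b.

Lemma balanced_ge h : \sum_i u i = 1 -> (forall i j, A i j <= 1) ->
  (forall i, a i <= h) -> forall j, 1 <= b j * h.
Proof.
move=> u1 A1 ah j; rewrite -(ab j) ler_wpM2l ?(ltW (b0 j))//.
rewrite -[leRHS]mul1r -u1 mulr_suml; apply: ler_sum => i _.
apply: ler_pM => //; rewrite ?mulr_ge0 ?(ltW (A0 _ _)) ?(ltW (u0 _)) ?(ltW (a0 _))//.
by rewrite -[leRHS]mul1r ler_wpM2r ?(ltW (u0 i)).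
Qed.

Variables (S : I -> J -> bool) (delta c : R).
Hypothesis AS : forall i j, S i j -> delta <= A i j.
Hypothesis delta0 : 0 < delta.
Hypothesis uS : forall j, c <= \sum_i u i * (S i j)%:R.

(** In the balance equation only the terms with [S i j] are kept, where A_ij >= delta. *)
Lemma balanced_dense_le j :
  delta * (\sum_i u i * a i * (S i j)%:R) * b j <= 1.
Proof.
rewrite -[leRHS](ab j) mulrC ler_wpM2l ?(ltW (b0 j))// mulr_sumr.
apply: ler_sum => i _; have ua0 := mulr_gt0 (u0 i) (a0 i).
rewrite -(mulrA (A i j)); have [Sij|_] := boolP (S i j).
  by rewrite mulr1 ler_wpM2r ?AS// ltW.
by rewrite !mulr0 mulr_ge0// ltW.
Qed.

Lemma balanced_le l : 0 <= l -> (forall i, l <= a i) ->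
  forall j, delta * c * l * b j <= 1.
Proof.
move=> l0 la j; apply: le_trans (balanced_dense_le j).
rewrite ler_wpM2r ?(ltW (b0 j))// -mulrA ler_wpM2l ?(ltW delta0)//.
apply: le_trans (ler_wpM2r l0 (uS j)) _.
rewrite mulr_suml; apply: ler_sum => i _.
by rewrite mulrAC ler_wpM2r ?ler0n// ler_wpM2l ?(ltW (u0 i)).
Qed.

(** Two columns of [S] of measure at least c share rows of measure at least 2 c - 1 >= kappa, on
    which both entries are at least delta la lb u_i. *)
Lemma overlap_ge kappa la lb : \sum_i u i = 1 -> 1 + kappa <= 2 * c ->
  0 <= la -> 0 <= lb -> (forall i, la <= a i) -> (forall j, lb <= b j) ->
  forall j j', delta * kappa * la * lb <=
    \sum_i Num.min (u i * a i * A i j * b j) (u i * a i * A i j' * b j').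
Proof.
move=> u1 kc la0 lb0 ala blb j j'.
pose k := delta * la * lb.
have k0 : 0 <= k by rewrite !mulr_ge0// ltW.
apply: (@le_trans _ _ (k * \sum_i (u i * (S i j)%:R + u i * (S i j')%:R - u i))).
  have -> : delta * kappa * la * lb = k * kappa by rewrite /k; ring.
  rewrite ler_wpM2l//.
  by rewrite sumrB big_split/= u1; have := uS j; have := uS j'; lra.
rewrite mulr_sumr; apply: ler_sum => i _.
have entry_ge j1 : S i j1 -> k * u i <= u i * a i * A i j1 * b j1.
  move=> Sij; rewrite /k mulrC [delta * la]mulrC !mulrA /=.
  apply: ler_pM => //; rewrite ?mulr_ge0 ?(ltW (u0 i)) ?(ltW delta0)//.
  apply: ler_pM => //; rewrite ?mulr_ge0 ?(ltW (u0 i)) ?(ltW delta0) ?AS//.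
  by rewrite ler_wpM2l ?(ltW (u0 i)).
have entry0 j1 : 0 <= u i * a i * A i j1 * b j1.
  by rewrite !mulr_ge0 ?(ltW (u0 i)) ?(ltW (a0 i)) ?(ltW (A0 i j1)) ?(ltW (b0 j1)).
rewrite le_min; apply/andP; split.
  have [/entry_ge|_] := boolP (S i j); have := entry0 j; have := ltW (u0 i);
  by case: (S i j') => /=; nra.
have [/entry_ge|_] := boolP (S i j'); have := entry0 j'; have := ltW (u0 i);
by case: (S i j) => /=; nra.
Qed.

End ScalingBounds.

(* The rows meeting column j0 in S have measure at least c and the columns
   meeting row i0 in S at least r, so a matrix with marginals u and v up to
   kappa/2 puts mass at least r + c - 1 - kappa/2 on the block they span. *)
Lemma dense_block_bound (R : realType) (I J : finType) (A : I -> J -> R)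
    (u : I -> R) (v : J -> R) (a : I -> R) (b b' : J -> R)
    (S : I -> J -> bool) (delta kappa r c : R) :
  (forall i j, 0 < A i j) -> (forall i j, A i j <= 1) ->
  (forall i, 0 < u i) -> (forall j, 0 < v j) ->
  \sum_i u i = 1 -> \sum_j v j = 1 ->
  (forall i, 0 < a i) -> (forall j, 0 < b j) ->
  balanced (fun j i => A i j) v b a -> balanced A u a b' ->
  0 < delta -> (forall i j, S i j -> delta <= A i j) ->
  (forall i, r <= \sum_j v j * (S i j)%:R) ->
  (forall j, c <= \sum_i u i * (S i j)%:R) ->
  1 + kappa <= r + c -> deviation v b b' <= kappa / 2 ->
  forall i j, delta ^+ 2 * kappa * (a i * b' j) <= 2.
Proof.
move=> A0 A1 u0 v0 u1 v1 a0 b0 ab ab' delta0 AS vS uS rc dev i0 j0.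
have b'0 := balanced_gt0 A0 u0 a0 ab'.
(* The balance equations bound delta X a_i0 and delta Y b'_j0 by 1, so it remains to bound X Y from
   below. *)
pose X := \sum_j v j * b j * (S i0 j)%:R.
pose Y := \sum_i u i * a i * (S i j0)%:R.
have hX : delta * X * a i0 <= 1.
  apply: (@balanced_dense_le R J I (fun j i => A i j) v b a _ _ _ _ _
    (fun j i => S i j)) => //.
  by move=> j i; exact: AS.
have hY : delta * Y * b' j0 <= 1 by apply: balanced_dense_le.
have X0 : 0 <= X.
  by apply: sumr_ge0 => j _; rewrite !mulr_ge0 ?ler0n ?(ltW (v0 j)) ?(ltW (b0 j)).
have Y0 : 0 <= Y.
  by apply: sumr_ge0 => i _; rewrite !mulr_ge0 ?ler0n ?(ltW (u0 i)) ?(ltW (a0 i)).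
have XY : kappa / 2 <= X * Y.
  pose P i j := u i * a i * (A i j * v j * b j).
  have P0 i j : 0 < P i j by rewrite !mulr_gt0.
  have Prow i : \sum_j P i j = u i by rewrite -mulr_sumr -mulrA ab mulr1.
  have Pcol j : \sum_i P i j = v j * (b j / b' j).
    rewrite (mulr1_eq (ab' j)) mulrA mulr_sumr.
    by apply: eq_bigr => i _; rewrite /P; ring.
  (* The weight is at most the indicator of the block, and P_ij <= u_i a_i v_j b_j since A <= 1;
     these bounds sum to X Y over the block. *)
  apply: (@le_trans _ _ (\sum_i \sum_j P i j * ((S i j0)%:R + (S i0 j)%:R - 1))).
    have -> : \sum_i \sum_j P i j * ((S i j0)%:R + (S i0 j)%:R - 1) =
        \sum_i u i * (S i j0)%:R + \sum_j v j * (b j / b' j) * (S i0 j)%:R - 1.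
      have -> : \sum_j v j * (b j / b' j) * (S i0 j)%:R =
          \sum_i \sum_j P i j * (S i0 j)%:R.
        by rewrite exchange_big; apply: eq_bigr => j _; rewrite -Pcol mulr_suml.
      rewrite -[X in _ = _ - X]u1 -big_split/= -sumrB; apply: eq_bigr => i _.
      rewrite -{1 2}(Prow i) mulr_suml -big_split/= -sumrB.
      by apply: eq_bigr => j _; ring.
    (* Replacing v by the column sums of P costs at most the deviation. *)
    have : \sum_j v j * (S i0 j)%:R - deviation v b b' <=
        \sum_j v j * (b j / b' j) * (S i0 j)%:R.
      rewrite -sumrB; apply: ler_sum => j _.
      rewrite -mulrBr -mulrA ler_wpM2l ?(ltW (v0 j))//.
      have := ler_norm (1 - b j / b' j); rewrite distrC.
      have := normr_ge0 (b j / b' j - 1).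
      by case: (S i0 j) => /=; lra.
    by have := vS i0; have := uS j0; lra.
  rewrite mulrC mulr_suml; apply: ler_sum => i _.
  rewrite mulr_sumr; apply: ler_sum => j _.
  have := P0 i j => Pij.
  have : P i j <= u i * a i * (v j * b j).
    rewrite /P ler_wpM2l ?mulr_ge0 ?(ltW (u0 i)) ?(ltW (a0 i))//.
    by rewrite -mulrA ger_pMl ?mulr_gt0// A1.
  by case: (S i j0); case: (S i0 j) => /=; lra.
have ab0 : 0 <= delta ^+ 2 * (a i0 * b' j0).
  by rewrite !mulr_ge0 ?exprn_ge0 ?(ltW (a0 i0)) ?(ltW (b'0 j0))// ltW.
have : (delta * X * a i0) * (delta * Y * b' j0) <= 1.
  rewrite -[leRHS](mulr1 1) ler_pM// !mulr_ge0//;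
  by rewrite ?(ltW (a0 i0)) ?(ltW (b'0 j0)) ?(ltW delta0).
have := ler_wpM2l ab0 XY.
by lra.
Qed.

(** * The orbit of alternately balanced factors *)

Section Orbit.
Variables (R : realType) (I J : finType).
Variables (A : I -> J -> R) (u : I -> R) (v : J -> R).
Variables (a : nat -> I -> R) (b : nat -> J -> R).
Variables (S : I -> J -> bool) (delta kappa r c : R).
Hypotheses (A0 : forall i j, 0 < A i j) (A1 : forall i j, A i j <= 1).
Hypotheses (u0 : forall i, 0 < u i) (v0 : forall j, 0 < v j).
Hypotheses (u1 : \sum_i u i = 1) (v1 : \sum_j v j = 1).
Hypotheses (a0 : forall t i, 0 < a t i) (b0 : forall t j, 0 < b t j).
Hypothesis ba : forall t, balanced (fun j i => A i j) v (b t) (a t).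
Hypothesis ab : forall t, balanced A u (a t) (b t.+1).
Hypotheses (delta0 : 0 < delta) (delta1 : delta <= 1).
Hypothesis AS : forall i j, S i j -> delta <= A i j.
Hypothesis vS : forall i, r <= \sum_j v j * (S i j)%:R.
Hypothesis uS : forall j, c <= \sum_i u i * (S i j)%:R.
Hypotheses (kappa0 : 0 < kappa) (kappa1 : kappa <= 1).
Hypothesis rc : 1 + kappa <= r + c.

(** This is the dual objective of entropic optimal transport without its mass term, which is
    constantly 1 by [ba]. *)
Definition dual_value t := \sum_i u i * ln (a t i) + \sum_j v j * ln (b t j).

Definition col_deviation t := deviation v (b t) (b t.+1).

Definition row_deviation t := deviation u (a t) (a t.+1).

Lemma row_deviation_le t : row_deviation t <= col_deviation t.
Proof. exact: (deviation_nonincreasing A0 u0 v0 u1 v1 (a0 t)). Qed.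

Lemma col_deviation_le t : col_deviation t.+1 <= row_deviation t.
Proof.
exact: (deviation_nonincreasing (A := fun j i => A i j) (fun j i => A0 i j)
  v0 u0 v1 u1 (b0 _)).
Qed.

Lemma deviation_homo t t' : (t <= t')%N -> col_deviation t' <= col_deviation t.
Proof.
elim: t' => [|t' IH]; first by rewrite leqn0 => /eqP ->.
rewrite leq_eqVlt => /orP[/eqP -> //|]; rewrite ltnS => /IH; apply: le_trans.
exact: le_trans (col_deviation_le _) (row_deviation_le _).
Qed.

Lemma ln_col_gain t s : 0 <= s -> 2 * s <= 1 ->
  \sum_j v j * ln (b t j) + s * col_deviation t <=
  \sum_j v j * ln (b t.+1 j) + 2 * s ^+ 2.
Proof. exact: (sum_ln_balanced A0 u0 v0 u1 v1 (a0 t) (b0 t)). Qed.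

Lemma ln_row_gain t :
  \sum_i u i * ln (a t i) <= \sum_i u i * ln (a t.+1 i).
Proof.
have := @sum_ln_balanced R J I (fun j i => A i j) v u (b t.+1) (a t) (a t.+1)
   (fun j i => A0 i j) v0 u0 v1 u1 (b0 _) (a0 _) (@ab t) (@ba t.+1) 0 (lexx 0).
by rewrite expr0n/= !mulr0 mul0r !addr0; apply.
Qed.

Lemma dual_value_gain t s : 0 <= s -> 2 * s <= 1 ->
  dual_value t + s * col_deviation t <= dual_value t.+1 + 2 * s ^+ 2.
Proof.
move=> s0 s1; have := ln_col_gain t s0 s1; have := ln_row_gain t.
by rewrite /dual_value; lra.
Qed.

Lemma dual_value_homo t t' : (t <= t')%N -> dual_value t <= dual_value t'.
Proof.
elim: t' => [|t' IH]; first by rewrite leqn0 => /eqP ->.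
rewrite leq_eqVlt => /orP[/eqP -> //|]; rewrite ltnS => /IH /le_trans; apply.
by have := @dual_value_gain t' 0 (lexx 0); rewrite expr0n/= !mulr0 mul0r !addr0; apply.
Qed.

Lemma dual_value_large_gain t : kappa / 2 < col_deviation t ->
  dual_value 0 + t.+1%:R * (kappa ^+ 2 / 32) <= dual_value t.+1.
Proof.
have step t' : kappa / 2 < col_deviation t' ->
    dual_value t' + kappa ^+ 2 / 32 <= dual_value t'.+1.
  (* The slope kappa / 8 maximises s kappa / 2 - 2 s ^ 2, with value kappa ^ 2 / 32. *)
  move=> h; have s0 : 0 <= kappa / 8 by have := kappa0; lra.
  have s1 : 2 * (kappa / 8) <= 1 by have := kappa1; lra.
  by have := dual_value_gain t' s0 s1; have := ler_wpM2l s0 (ltW h); lra.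
elim: t => [|t IH] h; first by have := step _ h; rewrite mul1r.
have /IH h' := lt_le_trans h (deviation_homo (leqnSn t)).
by have := step _ h; rewrite -[t.+2%:R]natr1; lra.
Qed.

Lemma sum_ln_prod (x : I -> R) (y : J -> R) :
  (forall i, 0 < x i) -> (forall j, 0 < y j) ->
  \sum_i u i * ln (x i) + \sum_j v j * ln (y j) =
  \sum_i \sum_j u i * v j * ln (x i * y j).
Proof.
move=> x0 y0.
transitivity (\sum_i \sum_j (u i * ln (x i) * v j + u i * (v j * ln (y j)))).
  rewrite (eq_bigr (fun i => u i * ln (x i) * \sum_j v j)); last first.
    by move=> i _; rewrite v1 mulr1.
  rewrite -[X in _ + X]mul1r -[X in _ + X * _]u1 mulr_suml -big_split/=.
  by apply: eq_bigr => i _; rewrite !mulr_sumr -big_split.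
apply: eq_bigr => i _; apply: eq_bigr => j _.
by rewrite lnM ?posrE//; ring.
Qed.

(** A crude bound, from ln x <= x and total mass 1. It serves to show that the deviation becomes
    small at some time, on which the sharper [dual_value_le] relies. *)
Lemma dual_value_bounded t : dual_value t <= \sum_i \sum_j (A i j)^-1.
Proof.
pose B := \sum_i \sum_j (A i j)^-1.
have AB i j : (A i j)^-1 <= B.
  apply: le_trans (_ : \sum_j (A i j)^-1 <= _).
    by rewrite (bigD1 j)//= lerDl sumr_ge0// => k _; rewrite invr_ge0 ltW.
  rewrite /B (bigD1 i)//= lerDl sumr_ge0// => k _; apply: sumr_ge0 => l _.
  by rewrite invr_ge0 ltW.
rewrite /dual_value sum_ln_prod//.
apply: (@le_trans _ _ (\sum_i B * \sum_j u i * (a t i * (A i j * v j * b t j)))).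
  apply: ler_sum => i _; rewrite mulr_sumr; apply: ler_sum => j _.
  have uv0 := mulr_gt0 (u0 i) (v0 j); have xy0 := mulr_gt0 (a0 t i) (b0 t j).
  apply: le_trans (_ : u i * v j * (a t i * b t j) <= _).
    by rewrite ler_wpM2l ?(ltW uv0)//; have := ln_le_subr1 xy0; lra.
  have BA : 1 <= B * A i j.
    by rewrite -[leLHS](mulVf (lt0r_neq0 (A0 i j))) ler_wpM2r ?(ltW (A0 i j)).
  have -> : B * (u i * (a t i * (A i j * v j * b t j))) =
    (B * A i j) * (u i * v j * (a t i * b t j)) by ring.
  by rewrite ler_peMl// ltW ?mulr_gt0.
rewrite -mulr_sumr (eq_bigr u) ?u1 ?mulr1// => i _.
by rewrite -!mulr_sumr ba mulr1.
Qed.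

Lemma small_deviation_exists : exists t, col_deviation t <= kappa / 2.
Proof.
apply: contrapT => /forallNP h.
have h' t : kappa / 2 < col_deviation t by rewrite ltNge; apply/negP/h.
pose B := \sum_i \sum_j (A i j)^-1.
pose x := (B - dual_value 0) / (kappa ^+ 2 / 32).
have k0 : 0 < kappa ^+ 2 / 32 by rewrite divr_gt0 ?exprn_gt0.
have := dual_value_large_gain (h' (Num.truncn x)).
have := truncnS_gt x; rewrite ltr_pdivrMr// => h1 h2.
by have := dual_value_bounded (Num.truncn x).+1; rewrite -/B; lra.
Qed.

Lemma scaling_le t : col_deviation t <= kappa / 2 ->
  forall i j, delta ^+ 2 * kappa * (a t i * b t.+1 j) <= 2.
Proof.
exact: (dense_block_bound A0 A1 u0 v0 u1 v1 (a0 t) (b0 t) (@ba t) (@ab t)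
  delta0 AS vS uS rc).
Qed.

(** The dual value never decreases, so it is enough to bound it at a later time T of small
    deviation. *)
Lemma dual_value_le t : dual_value t <= ln (2 / (delta ^+ 2 * kappa)).
Proof.
have [t' et'] := small_deviation_exists.
pose T := maxn t t'.
have eT : col_deviation T <= kappa / 2.
  by rewrite (le_trans _ et')// deviation_homo ?leq_maxr.
apply: le_trans (dual_value_homo (leq_maxl t t')) _; rewrite -/T.
(* [scaling_le] pairs a at time T with b at time T + 1, so b is rebalanced first, which does not
   lower the sum. *)
apply: le_trans (_ : \sum_i u i * ln (a T i) + \sum_j v j * ln (b T.+1 j) <= _).
  rewrite lerD2l.
  by have := @ln_col_gain T 0 (lexx 0); rewrite expr0n/= !mulr0 mul0r !addr0; apply.
have dk : 0 < delta ^+ 2 * kappa by rewrite mulr_gt0 ?exprn_gt0.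
set L := ln _.
rewrite sum_ln_prod//; apply: (@le_trans _ _ (\sum_i \sum_j u i * v j * L)).
  apply: ler_sum => i _; apply: ler_sum => j _.
  rewrite ler_wpM2l ?mulr_ge0 ?(ltW (u0 i)) ?(ltW (v0 j))//.
  rewrite /L ler_ln ?posrE ?divr_gt0 ?mulr_gt0//.
  by rewrite ler_pdivlMr// mulrC scaling_le.
rewrite (eq_bigr (fun i => u i * L)); first by rewrite -mulr_suml u1 mul1r.
by move=> i _; rewrite -mulr_suml -mulr_sumr v1 mulr1.
Qed.

Lemma small_deviation N :
  ln (2 / (delta ^+ 2 * kappa)) - dual_value 0 < N.+1%:R * (kappa ^+ 2 / 32) ->
  col_deviation N <= kappa / 2.
Proof.
move=> h; have [//|/dual_value_large_gain h'] := lerP (col_deviation N) (kappa / 2).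
by have := dual_value_le N.+1; lra.
Qed.

Lemma deviation_two_steps t : col_deviation t <= kappa / 2 ->
  col_deviation t.+2 <= (1 - delta ^+ 4 * kappa ^+ 3 / 2) * col_deviation t.
Proof.
move=> et.
have [i0] := inhabited_sum1 u1; have [j0] := inhabited_sum1 v1.
have r1 : r <= 1 := le_trans (vS i0) (marginal_measure_le1 (S i0) v0 v1).
have c1 : c <= 1 := le_trans (uS j0) (marginal_measure_le1 (S ^~ j0) u0 u1).
(* All bounds are relative to h, the largest a_i at time t. At t + 1, b lies in [1 / h, 1 / (l h)]
   and a in [l h, h / (delta kappa)]; at t + 2, b >= delta kappa / h. In the overlaps h cancels. *)
have [i1 _ ai1] := arg_maxP (a t) (isT : xpredT i0).
have {ai1}ah i : a t i <= a t i1 by exact: ai1.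
set h := a t i1 in ah; have h0 : 0 < h by exact: a0.
have hi0 : 0 <= h^-1 by rewrite invr_ge0 ltW.
have b1l j : h^-1 <= b t.+1 j.
  rewrite -[leLHS]mul1r ler_pdivrMr//.
  exact: (balanced_ge A0 u0 (a0 t) (b0 t.+1) (@ab t)).
pose l := delta ^+ 2 * kappa / 2.
have l0 : 0 < l by rewrite divr_gt0 ?mulr_gt0 ?exprn_gt0.
have b1u j : b t.+1 j <= (l * h)^-1.
  rewrite -[leRHS]mul1r ler_pdivlMr ?mulr_gt0//.
  by have := scaling_le et i1 j; rewrite /l -/h; lra.
have a1l i : l * h <= a t.+1 i.
  have := @balanced_ge R J I (fun j i => A i j) v _ _
    (fun j i => A0 i j) v0 (b0 t.+1) (a0 t.+1)
    (@ba t.+1) _ v1 (fun j i => A1 i j) b1u i.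
  by rewrite ler_pdivlMr ?mulr_gt0// mul1r; apply.
(* Here r >= kappa, because r + c >= 1 + kappa and c <= 1. *)
have a1u i : delta * kappa * a t.+1 i <= h.
  have := @balanced_le R J I (fun j i => A i j) v _ _
    (fun j i => A0 i j) v0 (b0 t.+1) (a0 t.+1)
    (@ba t.+1) (fun j i => S i j) delta r (fun j i => @AS i j) delta0 vS h^-1
    hi0 b1l i.
  rewrite mulrAC ler_pdivrMr// mul1r; apply: le_trans.
  by rewrite ler_wpM2r ?(ltW (a0 _ _))// ler_wpM2l ?(ltW delta0)//; have := rc; lra.
have b2l j : delta * kappa / h <= b t.+2 j.
  have dk : 0 < delta * kappa by rewrite mulr_gt0.
  have := @balanced_ge R I J A u _ _ A0 u0 (a0 t.+1) (b0 t.+2) (@ab t.+1)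
    (h / (delta * kappa)) u1 A1 _ j.
  rewrite mulrA ler_pdivlMr// mul1r ler_pdivrMr//; apply=> i.
  by rewrite ler_pdivlMr// mulrC.
have hn0 := lt0r_neq0 h0.
have e0 : 0 <= col_deviation t.
  by apply: sumr_ge0 => j _; rewrite mulr_ge0 ?(ltW (v0 j)).
(* If 2 c >= 1 + kappa, any two columns overlap, and the passage from column error to row error at
   time t + 1 contracts. *)
have [kc|kc] := lerP (1 + kappa) (2 * c).
  have ov j j' := overlap_ge A0 u0 (a0 t.+1) (b0 t.+2) AS delta0 uS u1 kc
    (ltW (mulr_gt0 l0 h0)) (divr_ge0 (mulr_ge0 (ltW delta0) (ltW kappa0)) (ltW h0))
    a1l b2l j j'.
  have := deviation_contraction A0 u0 v0 u1 v1 (a0 t.+1)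
    (@ba t.+1) (@ab t.+1) (@ba t.+2) ov.
  have -> : delta * kappa * (l * h) * (delta * kappa / h) =
      delta ^+ 4 * kappa ^+ 3 / 2 by rewrite /l; field.
  move=> contr; apply: le_trans (col_deviation_le _) _.
  apply: le_trans contr _; rewrite ler_wpM2l ?deviation_homo//.
  have d4 : delta ^+ 4 <= 1 by rewrite exprn_ile1// ltW.
  have k3 : kappa ^+ 3 <= 1 by rewrite exprn_ile1// ltW.
  have d40 : 0 <= delta ^+ 4 by rewrite exprn_ge0// ltW.
  have k30 : 0 <= kappa ^+ 3 by rewrite exprn_ge0// ltW.
  by nra.
(* Otherwise any two rows overlap, and the passage from the row error at t to the column error at t
   + 1 contracts, at least as strongly. *)
have kr : 1 + kappa <= 2 * r by have := rc; lra.
have ov i i' := @overlap_ge R J I (fun j i => A i j) v _ _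
    (fun j i => A0 i j) v0 (b0 t.+1) (a0 t.+1)
    (fun j i => S i j) delta r (fun j i => @AS i j) delta0 vS kappa h^-1 (l * h)
    v1 kr hi0 (ltW (mulr_gt0 l0 h0)) b1l a1l i i'.
have := deviation_contraction (A := fun j i => A i j) (fun j i => A0 i j)
    v0 u0 v1 u1 (b0 t.+1)
    (@ab t) (@ba t.+1) (@ab t.+1) ov.
have -> : delta * kappa / h * (l * h) = delta ^+ 3 * kappa ^+ 2 / 2.
  by rewrite /l; field.
move=> contr; apply: le_trans (deviation_homo (leqnSn t.+1)) _.
apply: le_trans contr _.
have dk : delta * kappa <= 1 by rewrite mulr_ile1 ?(ltW delta0) ?(ltW kappa0).
have x0 : 0 <= delta ^+ 3 * kappa ^+ 2.
  by rewrite mulr_ge0 ?exprn_ge0 ?(ltW delta0) ?(ltW kappa0).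
have x1 : delta ^+ 3 * kappa ^+ 2 <= 1.
  by rewrite mulr_ile1 ?exprn_ge0 ?exprn_ile1 ?(ltW delta0) ?(ltW kappa0).
apply: (@le_trans _ _ ((1 - delta ^+ 3 * kappa ^+ 2 / 2) * col_deviation t)).
  by rewrite ler_wpM2l//; [lra | exact: row_deviation_le].
rewrite ler_wpM2r// lerD2l lerN2 ler_pM2r ?invr_gt0//.
have -> : delta ^+ 4 * kappa ^+ 3 = delta ^+ 3 * kappa ^+ 2 * (delta * kappa).
  by ring.
by rewrite ler_piMr.
Qed.

Lemma deviation_geometric N k : col_deviation N <= kappa / 2 ->
  col_deviation (N + k.*2) <= (1 - delta ^+ 4 * kappa ^+ 3 / 2) ^+ k.
Proof.
move=> eN; have dk0 : 0 <= delta ^+ 4 * kappa ^+ 3.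
  by rewrite mulr_ge0 ?exprn_ge0 ?(ltW delta0) ?(ltW kappa0).
have dk1 : delta ^+ 4 * kappa ^+ 3 <= 1.
  by rewrite mulr_ile1 ?exprn_ge0 ?exprn_ile1 ?(ltW delta0) ?(ltW kappa0).
elim: k => [|k IH].
  by rewrite addn0 expr0 (le_trans eN)//; have := kappa1; lra.
rewrite doubleS !addnS; apply: le_trans (deviation_two_steps _) _.
  by rewrite (le_trans _ eN)// deviation_homo// leq_addr.
by rewrite [leRHS]exprS ler_wpM2l//; lra.
Qed.

End Orbit.

(** * Sinkhorn iterates as scalings *)

Definition balancing (R : realType) (I J : finType) (A : I -> J -> R)
    (u a : I -> R) (j : J) : R := (\sum_i A i j * u i * a i)^-1.

Lemma balancing_gt0 (R : realType) (I J : finType) (A : I -> J -> R)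
    (u a : I -> R) :
  (forall i j, 0 < A i j) -> (forall i, 0 < u i) -> \sum_i u i = 1 ->
  (forall i, 0 < a i) -> forall j, 0 < balancing A u a j.
Proof.
move=> A0 u0 u1 a0 j; have [i0] := inhabited_sum1 u1.
rewrite invr_gt0 (bigD1 i0)//= ltr_pwDl ?mulr_gt0//.
by apply: sumr_ge0 => i _; rewrite ltW ?mulr_gt0.
Qed.

Lemma balancing_balanced (R : realType) (I J : finType) (A : I -> J -> R)
    (u a : I -> R) :
  (forall j, 0 < balancing A u a j) -> balanced A u a (balancing A u a).
Proof. by move=> h j; rewrite mulVf// -invr_eq0; exact: lt0r_neq0 (h j). Qed.

Section SinkhornScalings.
Variables (R : realType) (m n : nat) (A : 'M[R]_(m, n)).
Variables (u : 'rV[R]_m) (v : 'rV[R]_n).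
Hypotheses (A0 : forall i j, 0 < A i j).
Hypotheses (u0 : forall i, 0 < u 0 i) (v0 : forall j, 0 < v 0 j).
Hypotheses (u1 : \sum_i u 0 i = 1) (v1 : \sum_j v 0 j = 1).

Definition row_factor (b : 'I_n -> R) : 'I_m -> R :=
  balancing (fun j i => A i j) (v 0) b.

Definition col_factor (a : 'I_m -> R) : 'I_n -> R :=
  balancing (fun i j => A i j) (u 0) a.

(* The first iterate scales the rows of A itself, so v_j b_j = 1 at time 0; the
   iterate of index 2t has factors row_scaling t and col_scaling t. *)
Definition col_scaling t : 'I_n -> R :=
  iter t (fun b => col_factor (row_factor b)) (fun j => (v 0 j)^-1).

Definition row_scaling t : 'I_m -> R := row_factor (col_scaling t).

Definition scaled (a : 'I_m -> R) (b : 'I_n -> R) : 'M[R]_(m, n) :=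
  \matrix_(i, j) (u 0 i * a i * A i j * v 0 j * b j).

Lemma row_factor_gt0 b : (forall j, 0 < b j) -> forall i, 0 < row_factor b i.
Proof. by move=> b0; apply: balancing_gt0. Qed.

Lemma col_scaling_gt0 t j : 0 < col_scaling t j.
Proof.
elim: t j => [|t IH] j; first by rewrite invr_gt0.
exact/balancing_gt0/row_factor_gt0.
Qed.

Lemma row_scaling_gt0 t i : 0 < row_scaling t i.
Proof. exact/row_factor_gt0/col_scaling_gt0. Qed.

Lemma row_scaling_balanced t :
  balanced (fun j i => A i j) (v 0) (col_scaling t) (row_scaling t).
Proof. exact/balancing_balanced/row_scaling_gt0. Qed.

Lemma col_scaling_balanced t :
  balanced (fun i j => A i j) (u 0) (row_scaling t) (col_scaling t.+1).
Proof. exact/balancing_balanced/(col_scaling_gt0 t.+1). Qed.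

(** Row scaling cancels any positive factor x on the rows, so earlier row factors leave no trace. *)
Lemma row_scale_scaled (x : 'I_m -> R) (b : 'I_n -> R) (B : 'M[R]_(m, n)) :
  (forall i, 0 < x i) ->
  (forall i j, B i j = x i * (A i j * v 0 j * b j)) ->
  row_scale u B = scaled (row_factor b) b.
Proof.
move=> x0 BE; apply/matrixP => i j; rewrite !mxE BE (eq_bigr _ (fun k _ => BE i k)).
rewrite -mulr_sumr invfM -[(\sum_k _)^-1]/(row_factor b i).
by have := x0 i => /lt0r_neq0 xi; field.
Qed.

Lemma col_scale_scaled (y : 'I_n -> R) (a : 'I_m -> R) (B : 'M[R]_(m, n)) :
  (forall j, 0 < y j) ->
  (forall i j, B i j = y j * (A i j * u 0 i * a i)) ->
  col_scale v B = scaled a (col_factor a).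
Proof.
move=> y0 BE; apply/matrixP => i j; rewrite !mxE BE (eq_bigr _ (fun k _ => BE k j)).
rewrite -mulr_sumr invfM -[(\sum_k _)^-1]/(col_factor a j).
by have := y0 j => /lt0r_neq0 yj; field.
Qed.

Lemma SK_even t : SK A u v t.*2 = scaled (row_scaling t) (col_scaling t).
Proof.
elim: t => [|t IH].
  apply: (@row_scale_scaled (fun=> 1)) => // i j.
  by rewrite /col_scaling /= -mulrA mulfV ?mulr1 ?mul1r// lt0r_neq0.
rewrite doubleS [LHS]/= odd_double/= IH.
apply: (@row_scale_scaled (fun i => u 0 i * row_scaling t i)) => [i|i j].
  by rewrite mulr_gt0 ?row_scaling_gt0.
rewrite (@col_scale_scaled (fun j => v 0 j * col_scaling t j) (row_scaling t)).
- by rewrite mxE /=; ring.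
- by move=> k; rewrite mulr_gt0 ?col_scaling_gt0.
- by move=> k l; rewrite mxE; ring.
Qed.

(** Even iterates have row sums exactly u, so only the column error remains. *)
Lemma SK_even_error t :
  l1norm (row_sums (SK A u v t.*2) - u) + l1norm (col_sums (SK A u v t.*2) - v) =
  deviation (v 0) (col_scaling t) (col_scaling t.+1).
Proof.
rewrite SK_even /l1norm big1 => [|i _]; last first.
  rewrite !mxE (eq_bigr (fun j => u 0 i * (row_scaling t i *
      (A i j * v 0 j * col_scaling t j)))); last by move=> j _; rewrite mxE; ring.
  by rewrite -!mulr_sumr row_scaling_balanced mulr1 subrr normr0.
rewrite add0r; apply: eq_bigr => j _; rewrite !mxE.
rewrite -[X in _ = X * _](gtr0_norm (v0 j)) -normrM mulrBr mulr1; congr `|_ - _|.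
rewrite (mulr1_eq (col_scaling_balanced t j)) mulrA mulr_sumr.
by apply: eq_bigr => i _; rewrite mxE; ring.
Qed.

(** As A <= 1, each initial row factor 1 / sum_j A_ij is at least 1 / n, and the column factors 1 /
    v_j are at least 1. *)
Lemma dual_value0_ge : (forall i j, A i j <= 1) ->
  - ln n%:R <= dual_value (u 0) (v 0) row_scaling col_scaling 0.
Proof.
move=> A1; have v_le1 j : v 0 j <= 1.
  by rewrite -v1 (bigD1 j)//= lerDl sumr_ge0// => k _; rewrite ltW.
rewrite /dual_value -[leLHS]addr0 lerD//; last first.
  apply: sumr_ge0 => j _; rewrite mulr_ge0 ?(ltW (v0 j))// ln_ge0//.
  by rewrite /col_scaling/= invf_ge1.
rewrite -[leLHS]mul1r -[X in X * _]u1 mulr_suml; apply: ler_sum => i _.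
rewrite ler_wpM2l ?(ltW (u0 i))//.
have n0 : (0 < n)%N by have [[k /(leq_ltn_trans _)]] := inhabited_sum1 v1; apply.
have si : \sum_j A i j * v 0 j * col_scaling 0 j = \sum_j A i j.
  by apply: eq_bigr => j _; rewrite -mulrA mulfV ?mulr1// lt0r_neq0.
have ri := row_scaling_gt0 0 i.
rewrite -lnV ?posrE ?ltr0n// ler_ln ?posrE ?ri ?invr_gt0 ?ltr0n//.
move: ri; rewrite /row_scaling /row_factor /balancing si invr_gt0 => s0.
rewrite lef_pV2 ?posrE ?ltr0n//.
rewrite -[leRHS]/(n%:R) -[n in _ <= n%:R]card_ord -sum1_card natr_sum.
exact: ler_sum.
Qed.

End SinkhornScalings.

(** * Iteration count and conclusion *)

Lemma l1norm_gt0E (R : realType) (n : nat) (x : 'rV[R]_n) :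
  (forall j, 0 < x 0 j) -> l1norm x = \sum_j x 0 j.
Proof. by move=> x0; apply: eq_bigr => j _; rewrite gtr0_norm. Qed.

Lemma ln2_ge_half (R : realType) : 1 <= 2 * ln (2 : R).
Proof.
have := @ln_le_subr1 R 2^-1; rewrite lnV ?posrE// invr_gt0 ltr0n => /(_ isT).
lra.
Qed.

(** At time N the error is at most kappa / 2, and k counts the contractions after it, each over two
    time units; time t is iterate 2 t, hence the last doubling. *)
Lemma iteration_budget (R : realType) (rho eps kappa lnn : R) :
  0 <= rho -> 0 < eps -> eps <= 1 -> 0 < kappa -> kappa <= 1 -> ln 2 <= lnn ->
  exists N k : nat,
  [/\ ln (2 / (expR (- rho) ^+ 2 * kappa)) + lnn < N.+1%:R * (kappa ^+ 2 / 32),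
      (1 - expR (- rho) ^+ 4 * kappa ^+ 3 / 2) ^+ k <= eps &
      (N + k.*2).*2%:R <= 144 * (expR (14 * rho) * kappa ^- 6 *
                            (rho + lnn - ln eps - ln kappa))].
Proof.
move=> rho0 eps0 eps1 kappa0 kappa1 lnn2.
have le0 : ln eps <= 0 by apply: ln_le0.
have lk0 : ln kappa <= 0 by apply: ln_le0.
have l2 := ln2_ge_half R.
set L := rho + _ - _ - _.
(* With L at least 1/2, the rounding of the two counts is absorbed in the bound. *)
have L1 : 1 <= 2 * L by rewrite /L; lra.
set G := expR (14 * rho) * kappa ^- 6.
have k1 : 1 <= kappa^-1 by rewrite invf_ge1.
have GE : G = expR (14 * rho) * kappa^-1 ^+ 6 by rewrite exprVn.
have kG : kappa^-1 ^+ 2 <= G.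
  rewrite GE -[leLHS]mul1r ler_pM ?exprn_ge0 ?invr_ge0 ?(ltW kappa0)//.
    by rewrite -expR0 ler_expR mulr_ge0.
  by rewrite ler_weXn2l.
have ekG : expR (4 * rho) * kappa^-1 ^+ 3 <= G.
  rewrite GE ler_pM ?exprn_ge0 ?invr_ge0 ?(ltW kappa0) ?expR_ge0//.
    by rewrite ler_expR; lra.
  by rewrite ler_weXn2l.
have G1 : 1 <= G by apply: le_trans kG; rewrite exprn_ege1.
(* X is the required dual gain divided by kappa ^ 2 / 32, and Y = - ln eps / theta suffices since (1
   - theta) ^ k <= exp (- theta k). *)
pose X := (ln 2 + 2 * rho - ln kappa + lnn) * (32 * kappa^-1 ^+ 2).
pose theta := expR (- rho) ^+ 4 * kappa ^+ 3 / 2.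
pose Y := - ln eps * (2 * (expR (4 * rho) * kappa^-1 ^+ 3)).
have kn0 := lt0r_neq0 kappa0.
have thetaY : theta * Y = - ln eps.
  rewrite /theta /Y -expRM_natl mulrN expRN.
  have e0 : expR (4 * rho) != 0 by rewrite lt0r_neq0// expR_gt0.
  by field; apply/andP.
have X0 : 0 <= X.
  by rewrite mulr_ge0 ?mulr_ge0 ?exprn_ge0 ?invr_ge0 ?(ltW kappa0)//; lra.
have Y0 : 0 <= Y.
  rewrite !mulr_ge0 ?oppr_ge0 ?expR_ge0 ?exprn_ge0 ?invr_ge0 ?(ltW kappa0)//.
exists (Num.truncn X), (Num.truncn Y).+1; split.
- have -> : ln (2 / (expR (- rho) ^+ 2 * kappa)) + lnn = X * (kappa ^+ 2 / 32).
    rewrite ln_div ?posrE ?mulr_gt0 ?exprn_gt0 ?expR_gt0//.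
    rewrite lnM ?posrE ?exprn_gt0 ?expR_gt0// lnXn ?expR_gt0// expRK /X.
    by field.
  by rewrite ltr_pM2r ?divr_gt0 ?exprn_gt0// truncnS_gt.
- have th0 : 0 < theta by rewrite divr_gt0 ?mulr_gt0 ?exprn_gt0 ?expR_gt0.
  have th1 : theta <= 1.
    have : expR (- rho) ^+ 4 * kappa ^+ 3 <= 1.
      rewrite mulr_ile1 ?exprn_ge0 ?exprn_ile1 ?expR_ge0 ?(ltW kappa0)//.
      by rewrite -expR0 ler_expR oppr_le0.
    by rewrite /theta; lra.
  rewrite -/theta; set k := (Num.truncn Y).+1.
  apply: (@le_trans _ _ (expR (- theta) ^+ k)).
    apply: lerXn2r; rewrite ?nnegrE ?expR_ge0 ?subr_ge0//.
    exact: expR_ge1Dx.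
  rewrite -expRM_natl -[leRHS](lnK (x := eps)) ?posrE// ler_expR.
  rewrite mulrN lerNl -thetaY mulrC ler_pM2r//.
  by rewrite ltW// truncnS_gt.
have tX : (Num.truncn X)%:R <= X by rewrite truncn_le.
have tY : (Num.truncn Y)%:R <= Y by rewrite truncn_le.
rewrite -muln2 natrM natrD -muln2 natrM -natr1.
(* The index is at most 2 X + 4 Y + 4, and 2 * 64 + 4 * 2 + 8 = 144, the 8 coming from 4 <= 8 G
   L. *)
have LX : X <= 64 * (G * L).
  apply: (@le_trans _ _ (2 * L * (32 * G))); last by lra.
  rewrite ler_pM ?mulr_ge0 ?exprn_ge0 ?invr_ge0 ?(ltW kappa0)//.
  - by lra.
  - by rewrite /L; lra.
  - by rewrite ler_pM2l.
have LY : Y <= 2 * (G * L).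
  apply: (@le_trans _ _ (L * (2 * G))); last by lra.
  rewrite ler_pM ?mulr_ge0 ?expR_ge0 ?exprn_ge0 ?invr_ge0 ?(ltW kappa0)//.
  - by lra.
  - by rewrite /L; lra.
  - by rewrite ler_pM2l.
have L0 : 0 <= L by lra.
have := ler_wpM2r L0 G1.
by rewrite mul1r; lra.
Qed.

(** The only column sum is the total mass 1, which is also the only entry of v. *)
Lemma deviation_single_column (R : realType) (m : nat) (A : 'M[R]_(m, 1))
    (u : 'rV[R]_m) (v : 'rV[R]_1) :
  (forall i j, 0 < A i j) -> (forall i, 0 < u 0 i) -> (forall j, 0 < v 0 j) ->
  \sum_i u 0 i = 1 -> \sum_j v 0 j = 1 ->
  deviation (v 0) (col_scaling A u v 0) (col_scaling A u v 1) = 0.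
Proof.
move=> A0 u0 v0 u1 v1.
have := balanced_mass u1 (row_scaling_balanced A0 u0 v0 u1 v1 0)
  (col_scaling_balanced A0 u0 v0 u1 v1 0).
move: v1; rewrite /deviation !big_ord1 => -> ; rewrite !mul1r => ->.
by rewrite subrr normr0.
Qed.

Theorem theorem1p1 (R : realType) :
  exists K : R, 0 < K /\
  forall (m n : nat) (u : 'rV[R]_m.+1) (v : 'rV[R]_n.+1)
         (rho eps kappa eta : R) (C : 'M[R]_(m.+1, n.+1)),
    (forall i, 0 < u 0 i) -> (forall j, 0 < v 0 j) ->
    l1norm u = 1 -> l1norm v = 1 ->
    0 <= rho ->
    0 < eps -> eps <= 1 ->
    0 < kappa -> kappa <= 1 ->
    (forall i j, 0 < C i j) ->
    0 < eta ->
    well_bounded rho kappa (eta *: C) u v ->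
    SK_outputs_within (map_mx expR (- (eta *: C))) u v
      (fun A => l1norm (row_sums A - u) + l1norm (col_sums A - v) <= eps)
      (K * (expR (14 * rho) * kappa ^- 6 *
            (rho + ln n.+1%:R - ln eps - ln kappa))).
Proof.
exists 144; split=> // m n u v rho eps kappa eta C u0 v0.
rewrite !l1norm_gt0E// => u1 v1 rho0 eps0 eps1 kappa0 kappa1 C0 eta0 wb.
set A := map_mx _ _.
have AE i j : A i j = expR (- (eta * C i j)) by rewrite !mxE.
have A0 i j : 0 < A i j by rewrite AE expR_gt0.
have A1 i j : A i j <= 1.
  by rewrite AE -expR0 ler_expR oppr_le0 mulr_ge0// ltW.
(* With a single column the logarithm of the dimension is 0 and the budget can vanish, so iterate 0
   must already succeed. *)
have [n0|n0] := posnP n.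
  subst n.
  exists 0%N; split.
    rewrite mulr_ge0// mulr_ge0 ?mulr_ge0 ?expR_ge0 ?invr_ge0 ?exprn_ge0//.
      exact: ltW.
    by have := ln_le0 eps1; have := ln_le0 kappa1; rewrite ln1; lra.
  have := SK_even_error A0 u0 v0 u1 v1 0; rewrite double0 => ->.
  by rewrite deviation_single_column// ltW.
pose S i j := eta * C i j <= rho.
have AS i j : S i j -> expR (- rho) <= A i j.
  by move=> Sij; rewrite AE ler_expR lerN2.
have vS i : r_rho rho (eta *: C) v <= \sum_j v 0 j * (S i j)%:R.
  apply: le_trans (bigmin_le _ i _) _.
  by apply: ler_sum => j _; rewrite mxE.
have uS j : c_rho rho (eta *: C) u <= \sum_i u 0 i * (S i j)%:R.
  apply: le_trans (bigmin_le _ j _) _.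
  by apply: ler_sum => i _; rewrite mxE.
have ln2n : ln 2 <= ln n.+1%:R :> R by rewrite ler_ln ?posrE ?ler_nat ?ltr0n.
have [N [k [hN hk hT]]] := iteration_budget rho0 eps0 eps1 kappa0 kappa1 ln2n.
exists (N + k.*2).*2; split=> //.
rewrite SK_even_error//; apply: le_trans hk.
have delta1 : expR (- rho) <= 1 by rewrite -expR0 ler_expR oppr_le0.
have ra := row_scaling_balanced A0 u0 v0 u1 v1.
have ca := col_scaling_balanced A0 u0 v0 u1 v1.
have ra0 := row_scaling_gt0 A0 u0 v0 u1 v1.
have ca0 := col_scaling_gt0 A0 u0 v0 u1 v1.
apply: (@deviation_geometric R _ _ (fun i j => A i j) (u 0) (v 0) _ _ S
  (expR (- rho)) kappa _ _ A0 A1 u0 v0 u1 v1 ra0 ca0 ra ca (expR_gt0 _) delta1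
  AS vS uS kappa0 kappa1 wb N k).
apply: (@small_deviation R _ _ (fun i j => A i j) (u 0) (v 0) _ _ S
  (expR (- rho)) kappa _ _ A0 A1 u0 v0 u1 v1 ra0 ca0 ra ca (expR_gt0 _)
  AS vS uS kappa0 kappa1 wb N).
apply: le_lt_trans hN; rewrite lerD2l lerNl.
exact: dual_value0_ge.
Qed.
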